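(* Let $N\ge 1$ and consider a constant-mean AMM pool of $N+1$ currencies with weights $w_0,\dots,w_N>0$, $\sum_i w_i=1$, relative variances $\sigma_{ij}^2\ge 0$, expected pair volumes $E[Q_{ij}]=E[Q_{ji}]\ge 0$, $E[Q_i]=\sum_{j\ne i}E[Q_{ij}]$, $E[Q]=\sum_{i<j}E[Q_{ij}]>0$, trade size $\Delta>0$, and $H_w=\sum_{i<j}w_iw_j\sigma_{ij}^2>0$. For a fee $f>0$ let the pool depth $V=V(f)$ be determined by the break-even condition $$\frac{H_w}{2}\,V = f\,E[Q],$$ and let the expected aggregate trading cost be $$c(f)=\sum_{i<j}E[Q_{ij}]\left(\frac{w_i+w_j}{w_iw_j}\cdot\frac{\Delta}{2V(f)}+f\right).$$ Then $c(f)$ is minimized over $f>0$ at $$f^*=\sqrt{\frac{\Delta H_w}{4(E[Q])^2}\sum_{i=0}^N\frac{E[Q_i]}{w_i}},$$ and the minimal value is $$c^*=c(f^* )=\sqrt{\Delta H_w\sum_{i=0}^N\frac{E[Q_i]}{w_i}}.$$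
   Context: Model: liquidity providers fund a pool with reserves $R_i$ of currencies $i=0,\dots,N$ (currency $0$ is the numeraire) governed by the invariant $\prod_i R_i^{w_i}=k$. $Q_{ij}$ is the (random) trading volume on the pair $(i,j)$, consisting of trades of fixed size $\Delta$ in numeraire. Each trader pays a unit cost equal to price impact plus the proportional fee $f$. The price impact of an $i\leftrightarrow j$ trade is taken to be its approximation $\frac{w_i+w_j}{w_iw_j}\frac{\Delta}{2V}$, where $V$ is the pool value. The expected impermanent loss per unit of pool value is taken to be its approximation $E[|\mathrm{IPL}|]=H_w/2$, where $\sigma_{ij}^2=\mathrm{Var}(x_i-x_j)$ and $x_i$ is the gross return of currency $i$ over the period. Competitive liquidity provision is expressed by the break-even condition $E[|\mathrm{IPL}|]\,V=E[Q]\,f$. *)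

(* Defs.v *)
From mathcomp Require Import all_boot all_order all_algebra.
From mathcomp Require Import reals.
Set Implicit Arguments.
Unset Strict Implicit.
Unset Printing Implicit Defensive.
Import Order.TTheory GRing.Theory Num.Theory.
Local Open Scope ring_scope.

(* A pool of N + 1 currencies is indexed by 'I_N.+1, with
   currency 0 the numeraire.  Throughout, w i is the weight of currency i,
   sigsq i j the relative variance Var(x_i - x_j) of the gross returns of
   i and j, and EQ i j the expected volume E[Q_ij] on the pair (i, j).
   The diagonal values sigsq i i and EQ i i are never used. *)

Section Pool.
Variables (R : realType) (N : nat).
Implicit Types (w : 'I_N.+1 -> R) (sigsq EQ : 'I_N.+1 -> 'I_N.+1 -> R).
Implicit Types (Delta f V : R).

Definition sum_pairs (F : 'I_N.+1 -> 'I_N.+1 -> R) : R :=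
  \sum_(i < N.+1) \sum_(j < N.+1 | (i < j)%N) F i j.

(* H_w *)
Definition weighted_variance w sigsq : R :=
  sum_pairs (fun i j => w i * w j * sigsq i j).

(* E[|IPL|], per unit of pool value, taken at its second-order value H_w / 2 *)
Definition expected_loss w sigsq : R := weighted_variance w sigsq / 2.

(* E[Q_i] *)
Definition currency_volume EQ (i : 'I_N.+1) : R :=
  \sum_(j < N.+1 | j != i) EQ i j.

(* E[Q]: each unordered pair is counted once *)
Definition total_volume EQ : R := sum_pairs EQ.

Definition price_impact w Delta V (i j : 'I_N.+1) : R :=
  (w i + w j) / (w i * w j) * (Delta / (2 * V)).

(* Competitive liquidity provision: expected losses equal expected fees. *)
Definition break_even w sigsq EQ f V : Prop :=
  expected_loss w sigsq * V = f * total_volume EQ.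

Definition trading_cost w EQ Delta V f : R :=
  sum_pairs (fun i j => EQ i j * (price_impact w Delta V i j + f)).

Definition optimal_fee w sigsq EQ Delta : R :=
  Num.sqrt (Delta * weighted_variance w sigsq / (4 * total_volume EQ ^+ 2)
            * \sum_(i < N.+1) currency_volume EQ i / w i).

End Pool.

(* Main.v *)
(* By symmetry of the volumes, sum_i E[Q_i] / w_i is the sum over pairs of
   E[Q_ij] (1 / w_i + 1 / w_j).  Substituting V = 2 f E[Q] / H_w, the cost becomes
   s^2 / (4 f E[Q]) + f E[Q] with s^2 = Delta H_w sum_i E[Q_i] / w_i.  By AM-GM
   it is at least s, with equality when f E[Q] = s / 2. *)
Require Import Defs.
From mathcomp Require Import all_boot all_order all_algebra.
From mathcomp Require Import reals.
From mathcomp Require Import ring.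
Import Order.TTheory GRing.Theory Num.Theory.
Local Open Scope ring_scope.

(** Exchanging the order of summation in the [F j i] half makes it run over [j < i]. Together with
    the [i < j] half it covers exactly the off-diagonal indices. *)
Lemma sum_pairs_sym (R : realType) (N : nat) (F : 'I_N.+1 -> 'I_N.+1 -> R) :
  sum_pairs (fun i j => F i j + F j i) =
  \sum_(i < N.+1) \sum_(j < N.+1 | j != i) F i j.
Proof.
rewrite /sum_pairs.
under eq_bigr => i _ do rewrite big_split /=.
rewrite big_split /= [X in _ + X](exchange_big_dep predT) //= -big_split /=.
apply: eq_bigr => i _; rewrite [RHS](bigID (fun j : 'I_N.+1 => (i < j)%N)) /=.
by congr (_ + _); apply: eq_bigl => j; rewrite -val_eqE /=; case: ltngtP.
Qed.

Lemma eq_sum_pairs (R : realType) (N : nat) (F G : 'I_N.+1 -> 'I_N.+1 -> R) :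
  (forall i j, i != j -> F i j = G i j) -> sum_pairs F = sum_pairs G.
Proof.
move=> eqFG; apply: eq_bigr => i _; apply: eq_bigr => j ltij.
by apply: eqFG; rewrite -val_eqE /= ltn_eqF.
Qed.

Lemma le_sum_pairs (R : realType) (N : nat) (F G : 'I_N.+1 -> 'I_N.+1 -> R) :
  (forall i j, i != j -> F i j <= G i j) -> sum_pairs F <= sum_pairs G.
Proof.
move=> leFG; apply: ler_sum => i _; apply: ler_sum => j ltij.
by apply: leFG; rewrite -val_eqE /= ltn_eqF.
Qed.

Lemma weighted_volumeE (R : realType) (N : nat) (w : 'I_N.+1 -> R)
    (EQ : 'I_N.+1 -> 'I_N.+1 -> R) :
  (forall i j, i != j -> EQ i j = EQ j i) ->
  \sum_(i < N.+1) currency_volume EQ i / w i =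
  sum_pairs (fun i j => EQ i j * ((w i)^-1 + (w j)^-1)).
Proof.
move=> EQsym.
transitivity (sum_pairs (fun i j => EQ i j / w i + EQ j i / w j)).
  by rewrite sum_pairs_sym; apply: eq_bigr => i _; rewrite mulr_suml.
by apply: eq_sum_pairs => i j ij; rewrite -(EQsym i j ij) mulrDr.
Qed.

(** Positive weights summing to 1 are each at most 1, so in every pair [1 / w i] alone is already at
    least 1. This bound transfers positivity from the total volume to the weighted sum. *)
Lemma total_le_weighted_volume (R : realType) (N : nat) (w : 'I_N.+1 -> R)
    (EQ : 'I_N.+1 -> 'I_N.+1 -> R) :
  (forall i, 0 < w i) -> \sum_(i < N.+1) w i = 1 ->
  (forall i j, i != j -> EQ i j = EQ j i) ->
  (forall i j, i != j -> 0 <= EQ i j) ->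
  total_volume EQ <= \sum_(i < N.+1) currency_volume EQ i / w i.
Proof.
move=> w_gt0 w1 EQsym EQ_ge0; rewrite weighted_volumeE //.
apply: le_sum_pairs => i j ij; rewrite ler_peMr ?EQ_ge0 //.
have wi_le1 : w i <= 1.
  by rewrite -w1 (bigD1 i) //= lerDl sumr_ge0 // => k _; rewrite ltW.
by rewrite -[1]addr0 lerD ?invr_ge0 ?(ltW (w_gt0 j)) // invf_ge1.
Qed.

(** Since [(w i + w j) / (w i * w j)] equals [1 / w i + 1 / w j], the depth factors out of the sum
    over pairs. *)
Lemma trading_costE (R : realType) (N : nat) (w : 'I_N.+1 -> R)
    (EQ : 'I_N.+1 -> 'I_N.+1 -> R) (Delta V f : R) :
  (forall i, 0 < w i) -> (forall i j, i != j -> EQ i j = EQ j i) ->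
  trading_cost w EQ Delta V f =
  Delta / (2 * V) * (\sum_(i < N.+1) currency_volume EQ i / w i)
  + f * total_volume EQ.
Proof.
move=> w_gt0 EQsym; rewrite weighted_volumeE // /total_volume /sum_pairs !mulr_sumr.
rewrite -big_split; apply: eq_bigr => i _ /=; rewrite !mulr_sumr -big_split /=.
apply: eq_bigr => j _; rewrite /price_impact invrM ?unitfE ?gt_eqF //.
have : w i != 0 by rewrite gt_eqF.
have : w j != 0 by rewrite gt_eqF.
(* Abstracting [Delta / (2 * V)] spares [field] the side condition [V != 0], so [V] stays
   arbitrary. *)
move: (Delta / _) => d wj wi.
by field; rewrite wi wj.
Qed.

Theorem proposition5 (R : realType) (N : nat)
    (w : 'I_N.+1 -> R) (sigsq EQ : 'I_N.+1 -> 'I_N.+1 -> R)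
    (Delta : R) (V : R -> R)
    (hN : (1 <= N)%N)
    (hw : forall i, 0 < w i)
    (hw1 : \sum_(i < N.+1) w i = 1)
    (hsigsq : forall i j, i != j -> 0 <= sigsq i j)
    (hEQsym : forall i j, i != j -> EQ i j = EQ j i)
    (hEQ : forall i j, i != j -> 0 <= EQ i j)
    (hQ : 0 < total_volume EQ)
    (hDelta : 0 < Delta)
    (hH : 0 < weighted_variance w sigsq)
    (hV : forall f, 0 < f -> break_even w sigsq EQ f (V f)) :
  let c := fun f : R => trading_cost w EQ Delta (V f) f in
  let fstar := optimal_fee w sigsq EQ Delta in
  [/\ 0 < fstar,
      forall f, 0 < f -> c fstar <= c f
    & c fstar = Num.sqrt (Delta * weighted_variance w sigsq
                          * \sum_(i < N.+1) currency_volume EQ i / w i)].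
Proof.
move=> c fstar.
set Q := total_volume EQ in hQ *; set H := weighted_variance w sigsq in hH *.
set S := \sum_(i < N.+1) currency_volume EQ i / w i.
have S_gt0 : 0 < S by apply: (lt_le_trans hQ); apply: total_le_weighted_volume.
set s := Num.sqrt (Delta * H * S).
have s_gt0 : 0 < s by rewrite sqrtr_gt0 !mulr_gt0.
have s2 : s ^+ 2 = Delta * H * S by rewrite sqr_sqrtr // !mulr_ge0 ?ltW.
have fstarE : fstar = s / (2 * Q).
  rewrite /fstar /optimal_fee -/Q -/H -/S.
  (* The radicand is a perfect square, and its root is positive. *)
  have -> : Delta * H / (4 * Q ^+ 2) * S = (s / (2 * Q)) ^+ 2.
    by rewrite expr_div_n s2; field; rewrite gt_eqF.
  by rewrite sqrtr_sqr gtr0_norm // divr_gt0 // mulr_gt0.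
have cE f : 0 < f -> c f = s ^+ 2 / (4 * (f * Q)) + f * Q.
  move=> f_gt0; rewrite /c trading_costE // -/S -/Q s2.
  (* The break-even condition is solved for the depth, using [H > 0]. *)
  have -> : V f = 2 * (f * Q) / H.
    have := hV f f_gt0; rewrite /break_even /expected_loss -/H -/Q => <-.
    by field; rewrite gt_eqF.
  by field; rewrite !gt_eqF.
have fstar_gt0 : 0 < fstar by rewrite fstarE divr_gt0 // mulr_gt0.
(* At [fstar], price impact and fees contribute [s / 2] each. *)
have cfstar : c fstar = s.
  by rewrite cE // fstarE; field; rewrite !gt_eqF.
split=> // f f_gt0; rewrite cfstar cE //.
have x_gt0 : 0 < f * Q by rewrite mulr_gt0.
(* The cost depends on [f] only through the fee revenue [x = f * Q]; completing the square then
   shows its excess over [s] to be nonnegative. *)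
move: (f * Q) x_gt0 => x x_gt0; rewrite -subr_ge0.
have -> : s ^+ 2 / (4 * x) + x - s = (s - 2 * x) ^+ 2 / (4 * x).
  by field; rewrite gt_eqF.
by rewrite divr_ge0 ?sqr_ge0 // mulr_ge0 // ltW.
Qed.
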